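(* Let $X\ne\{0\}$ be a real reflexive Banach space. Let $b:X\to(-\infty,\infty]$ be lower semicontinuous, convex and proper, with $U:=\mathrm{Int}(\mathrm{dom}(b))\ne\emptyset$, and suppose $b$ is Gâteaux differentiable in $U$. Let $S\subseteq\mathrm{dom}(b)$ be nonempty, closed and convex, with $S\cap U\neq\emptyset$, and suppose $b$ is strictly convex on $S$. Let $f:\mathrm{dom}(b)\to\mathbb{R}$ be convex on $\mathrm{dom}(b)$ and Gâteaux differentiable in $U$, and let $g:S\to(-\infty,\infty]$ be proper, lower semicontinuous and convex. Assume that there exists a point in $\mathrm{dom}(g)$ at which either $b$ or $g$ is continuous. Fix $L>0$, $\mu>0$ and $y\in U$, and assume that at least one of the following holds: (i) $S$ is bounded; (ii) $S$ is unbounded and $b$ is uniformly convex relative to $(S,\{y\})$ with a relative gauge $\psi$ satisfying $\lim_{t\to\infty}\psi(t)/t=\infty$. Let $F(x):=f(x)+g(x)$ for $x\in S$. Suppose that the (unique) minimizer $z$ over $S$ of the function $u_y(x):=Q_{L,\mu,S}(x,y)$, $x\in S$, satisfies $z\in S\cap U$ and $$F(z)\le Q_{L,\mu,S}(z,y).$$ Then for all $x\in S$, $$F(x)-F(z)\ge\frac{L}{\mu}\bigl(B(x,z)-B(x,y)\bigr).$$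
   Context: $\mathrm{dom}(h)$ is the set where $h$ is finite ($<\infty$). The Bregman divergence of $b$ is $B(x,y):=b(x)-b(y)-\langle b'(y),x-y\rangle$ for $(x,y)\in\mathrm{dom}(b)\times U$ and $B(x,y):=\infty$ otherwise, where $b'$ is the Gâteaux gradient of $b$. For $x\in S$, $y\in U$, $$Q_{L,\mu,S}(x,y):=f(y)+\langle f'(y),x-y\rangle+\frac{L}{\mu}B(x,y)+g(x).$$ For nonempty $S_1,S_2\subseteq\mathrm{dom}(b)$, $b$ is uniformly convex relative to $(S_1,S_2)$ with relative gauge $\psi:[0,\infty)\to[0,\infty]$ if $\psi(t)>0$ for $t>0$ and $b(\lambda x+(1-\lambda)w)+\lambda(1-\lambda)\psi(\|x-w\|)\le\lambda b(x)+(1-\lambda)b(w)$ for all $\lambda\in(0,1)$, $(x,w)\in S_1\times S_2$. Under the stated hypotheses $u_y$ has a unique minimizer in $S$. *)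

(* Defs.v *)
From HB Require Import structures.
From mathcomp Require Import all_boot all_order all_algebra.
From mathcomp Require Import all_classical all_reals all_analysis.

Set Implicit Arguments.
Unset Strict Implicit.
Unset Printing Implicit Defensive.

Import Order.TTheory GRing.Theory Num.Theory.
Import numFieldNormedType.Exports.

Local Open Scope classical_set_scope.
Local Open Scope ring_scope.

(* Partial functions are represented by total ones whose values off the domain
   are never used: f : dom b -> R becomes f : X -> R, and g : S -> (-oo, +oo]
   becomes g : X -> \bar R, every condition on g being relativised to S. *)

Definition dual (R : realType) (X : normedModType R) : set (X -> R) :=
  [set phi : X -> R | scalar phi /\ continuous (phi : X -> R^o)].

Definition dual_norm (R : realType) (X : normedModType R) (phi : X -> R) : R :=
  sup [set `|phi x| | x in [set x : X | `|x| <= 1]].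

(* Only the restriction of Phi to the dual of X is meaningful. *)
Definition bidual (R : realType) (X : normedModType R) : set ((X -> R) -> R) :=
  [set Phi : (X -> R) -> R |
    (forall (a : R) (phi psi : X -> R), dual phi -> dual psi ->
       Phi (fun x => a * phi x + psi x) = a * Phi phi + Phi psi) /\
    (exists C : R, forall phi : X -> R, dual phi ->
       `|Phi phi| <= C * dual_norm phi)].

Definition reflexive_space (R : realType) (X : normedModType R) : Prop :=
  forall Phi : (X -> R) -> R, bidual Phi ->
    exists x : X, forall phi : X -> R, dual phi -> Phi phi = phi x.

Definition grad (R : realType) (X : normedModType R) (h : X -> R) (x : X) :
    X -> R :=
  fun v => 'D_v (h : X -> R^o) x.

Definition gateaux_differentiable (R : realType) (X : normedModType R)
    (h : X -> R) (x : X) : Prop :=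
  (forall v : X, derivable (h : X -> R^o) x v) /\ dual (grad h x).

Section ExtendedRealValued.
Local Open Scope ereal_scope.

Definition dom_on (R : realType) (X : normedModType R) (S : set X)
    (h : X -> \bar R) : set X :=
  [set x | S x /\ h x < +oo].

Definition dom (R : realType) (X : normedModType R) (h : X -> \bar R) : set X :=
  dom_on setT h.

Definition int_dom (R : realType) (X : normedModType R) (h : X -> \bar R) :
    set X :=
  interior (dom h).

Definition proper_on (R : realType) (X : normedModType R) (S : set X)
    (h : X -> \bar R) : Prop :=
  (forall x, S x -> -oo < h x) /\ dom_on S h !=set0.

(* At points outside S, subspace S is discrete, so this only constrains h at
   the points of S, along S. *)
Definition lower_semicontinuous_on (R : realType) (X : normedModType R)
    (S : set X) (h : X -> \bar R) : Prop :=
  lower_semicontinuous (h : subspace S -> \bar R).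

Definition continuous_on_at (R : realType) (X : normedModType R)
    (S : set X) (h : X -> \bar R) (p : X) : Prop :=
  {for (p : subspace S), continuous (h : subspace S -> \bar R)}.

Definition convex_on (R : realType) (X : normedModType R) (S : set X)
    (h : X -> \bar R) : Prop :=
  forall (x w : X) (lambda : R), S x -> S w ->
    (0 < lambda < 1)%R ->
    h (lambda *: x + (1 - lambda) *: w)%R <=
      lambda%:E * h x + (1 - lambda)%:E * h w.

Definition strictly_convex_on (R : realType) (X : normedModType R) (S : set X)
    (h : X -> \bar R) : Prop :=
  forall (x w : X) (lambda : R), S x -> S w -> x != w ->
    (0 < lambda < 1)%R ->
    h (lambda *: x + (1 - lambda) *: w)%R <
      lambda%:E * h x + (1 - lambda)%:E * h w.

(* The gauge psi : [0, +oo[ -> [0, +oo] is only looked at on [0, +oo[. *)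
Definition uniformly_convex_relative (R : realType) (X : normedModType R)
    (b : X -> \bar R) (S1 S2 : set X) (psi : R -> \bar R) : Prop :=
  [/\ (S1 !=set0 /\ S1 `<=` dom b),
      (S2 !=set0 /\ S2 `<=` dom b),
      (forall t : R, (0 <= t)%R -> 0 <= psi t),
      (forall t : R, (0 < t)%R -> 0 < psi t) &
      forall (lambda : R) (x w : X), (0 < lambda < 1)%R -> S1 x -> S2 w ->
        b (lambda *: x + (1 - lambda) *: w)%R +
          (lambda * (1 - lambda))%:E * psi `|x - w|%R <=
        lambda%:E * b x + (1 - lambda)%:E * b w].

(* On the interior of its domain b is finite around every point, so there the
   Gateaux gradient of b is the one of fine \o b. *)
Definition bregman (R : realType) (X : normedModType R) (b : X -> \bar R)
    (x y : X) : \bar R :=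
  if (x \in dom b) && (y \in int_dom b)
  then b x - b y - (grad (fine \o b) y (x - y)%R)%:E
  else +oo.

Definition Q (R : realType) (X : normedModType R) (b : X -> \bar R)
    (f : X -> R) (g : X -> \bar R) (L mu : R) (x y : X) : \bar R :=
  (f y)%:E + (grad f y (x - y)%R)%:E + (L / mu)%:E * bregman b x y + g x.

Definition minimizer_on (R : realType) (X : normedModType R) (S : set X)
    (u : X -> \bar R) (z : X) : Prop :=
  S z /\ forall x : X, S x -> u z <= u x.

End ExtendedRealValued.

(* Main.v *)
Require Import Defs.
From mathcomp Require Import all_boot all_order all_algebra.
From mathcomp Require Import all_classical all_reals all_analysis.
From mathcomp Require Import ring lra.

Import Order.TTheory GRing.Theory Num.Theory.
Import numFieldNormedType.Exports.

Local Open Scope classical_set_scope.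
Local Open Scope ring_scope.

(** Write c = L / mu, and let b', f' be the Gateaux gradients.  Up to a
    constant, the function minimized by z is the sum of the linear functional
    f'(y) - c b'(y), of c b and of g.  Moving from z towards x along the segment
    [z, x], bounding g on that segment by convexity, and letting the step tend
    to 0 (b is Gateaux differentiable at z) gives the first-order condition
      g(z) - g(x) <= <f'(y), x - z> + c <b'(z) - b'(y), x - z>.
    This is [composite_minimizer_ineq].  The gradient inequality for f at y
    ([gradient_ineq]) bounds f(x) below by f(y) + <f'(y), x - y>, and the
    hypothesis on z bounds F(z) above by Q(z, y).  Adding up, the f-terms
    cancel and what remains is
      F(x) - F(z) >= - c (B(z, y) + <b'(z) - b'(y), x - z>),
    whose right-hand side is c (B(x, z) - B(x, y)) by the three-point identity
    of the Bregman divergence. *)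

Lemma scalarB {R : realType} {X : normedModType R} {phi : X -> R} (u v : X) :
  scalar phi -> phi (u - v) = phi u - phi v.
Proof. by move=> lphi; rewrite -scaleN1r addrC lphi mulN1r addrC. Qed.

(** The limit defining the derivative is two-sided; its right-hand part is
    enough to compare it with chord slopes, and is all that is known when x is
    an endpoint of the segment along which h is controlled. *)
Lemma derive_ge_chord {R : realType} {X : normedModType R} {h : X -> R}
    {x v : X} {A : R} :
  derivable (h : X -> R^o) x v ->
  (forall t : R, 0 < t < 1 -> t * A <= h (t *: v + x) - h x) ->
  A <= grad h x v.
Proof.
move=> dh chord.
apply: (cvgr_to_ge (F := 0^'+) (cvg_dnbhs_at_right dh)).
near=> t.
have t0 : 0 < t by near: t; exact: nbhs_right_gt.
have t1 : t < 1 by near: t; exact: nbhs_right_lt.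
rewrite /= -[leLHS](mulKf (lt0r_neq0 t0)).
by apply: ler_wpM2l; [rewrite invr_ge0 ltW|apply: chord; rewrite t0].
Unshelve. all: by end_near. Qed.

Lemma derive_le_chord {R : realType} {X : normedModType R} {h : X -> R}
    {x v : X} {A : R} :
  derivable (h : X -> R^o) x v ->
  (forall t : R, 0 < t < 1 -> h (t *: v + x) - h x <= t * A) ->
  grad h x v <= A.
Proof.
move=> dh chord; rewrite -[leLHS]opprK lerNl.
have -> : - grad h x v = grad (fun w => - h w) x v.
  by rewrite /grad [RHS](deriveN dh).
apply: derive_ge_chord; first exact: derivableN.
by move=> t /chord; lra.
Qed.

Lemma segment_shift {R : realType} {X : normedModType R} (x z : X) (t : R) :
  t *: x + (1 - t) *: z = t *: (x - z) + z.
Proof. by rewrite scalerBl scale1r scalerBr addrCA addrC. Qed.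

Lemma gradient_ineq {R : realType} {X : normedModType R} {D : set X}
    {f : X -> R} {x y : X} :
  convex_function D f -> D x -> D y ->
  derivable (f : X -> R^o) y (x - y) ->
  f y + grad f y (x - y) <= f x.
Proof.
move=> cf Dx Dy df; rewrite addrC -lerBrDr.
apply: derive_le_chord => // t /andP[t0 t1].
have := cf (Itv01 (ltW t0) (ltW t1)) x y (mem_set Dx) (mem_set Dy).
rewrite convRE /= -segment_shift /conv/= /unstable.onem; lra.
Qed.

(** First-order condition for a composite objective: only the part h is
    differentiated, the convex part g entering through its values. *)
Lemma composite_minimizer_ineq {R : realType} {X : normedModType R}
    {S : set X} {phi h : X -> R} {g : X -> \bar R} {c : R} {x z : X} :
  0 < c -> scalar phi -> convex_set S -> convex_on S g -> S x -> S z ->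
  g x \is a fin_num -> g z \is a fin_num ->
  derivable (h : X -> R^o) z (x - z) ->
  minimizer_on S (fun w => (phi w + c * h w)%:E + g w)%E z ->
  fine (g z) - fine (g x) <= phi (x - z) + c * grad h z (x - z).
Proof.
move=> c0 lphi cS cg Sx Sz gx gz dh [_ zmin].
suff : c^-1 * (fine (g z) - fine (g x) - phi (x - z)) <= grad h z (x - z).
  by rewrite mulrC ler_pdivrMr //; lra.
apply: derive_ge_chord => // t /andP[t0 t1].
set w := t *: (x - z) + z.
have wE : t *: x + (1 - t) *: z = w by exact: segment_shift.
have Sw : S w.
  have := cS x z (Itv01 (ltW t0) (ltW t1)) (mem_set Sx) (mem_set Sz).
  by move=> /set_mem; rewrite -wE.
have gw : (g w <= (t * fine (g x) + (1 - t) * fine (g z))%:E)%E.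
  have t01 : 0 < t < 1 by rewrite t0.
  have := cg x z t Sx Sz t01.
  by rewrite wE -{1}(fineK gx) -{1}(fineK gz).
have := le_trans (zmin _ Sw) (leeD2l _ gw).
rewrite -{1}(fineK gz) -!EFinD lee_fin /w lphi => ineq.
rewrite mulrCA ler_pdivrMl //; lra.
Qed.

Section BregmanReal.
Context {R : realType} {X : normedModType R} {b : X -> \bar R}.

Lemma fin_num_dom {x : X} : proper_on setT b -> dom b x -> b x \is a fin_num.
Proof. by move=> [b_gtNy _] [_ bx]; rewrite fin_real// bx b_gtNy. Qed.

Lemma bregmanE {x y : X} : proper_on setT b -> dom b x -> int_dom b y ->
  bregman b x y =
    (fine (b x) - fine (b y) - grad (fine \o b) y (x - y))%:E.
Proof.
move=> b_proper domx intdomy; rewrite /bregman !mem_set //=.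
have finy := fin_num_dom b_proper (interior_subset intdomy).
by rewrite -{1}(fineK (fin_num_dom b_proper domx)) -{1}(fineK finy).
Qed.

(** Only g can make the value infinite: this isolates the part of the objective
    on which real arithmetic applies. *)
Lemma Q_E (f : X -> R) (g : X -> \bar R) (L mu : R) {x y : X} :
  proper_on setT b -> dom b x -> int_dom b y ->
  Q b f g L mu x y =
    ((f y + grad f y (x - y) +
      L / mu * (fine (b x) - fine (b y) - grad (fine \o b) y (x - y)))%:E
     + g x)%E.
Proof. by move=> *; rewrite /Q bregmanE. Qed.

End BregmanReal.

Theorem lemma8p6 (R : realType) (X : completeNormedModType R)
  (b : X -> \bar R) (S : set X) (f : X -> R) (g : X -> \bar R)
  (L mu : R) (y z : X)
  (F : X -> \bar R := fun x => ((f x)%:E + g x)%E)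
  (U : set X := int_dom b) :
  (exists v : X, v != 0) ->
  reflexive_space X ->
  lower_semicontinuous b -> convex_on setT b -> proper_on setT b ->
  U !=set0 ->
  (forall x, U x -> gateaux_differentiable (fine \o b) x) ->
  S `<=` dom b -> S !=set0 -> closed S -> convex_set S ->
  S `&` U !=set0 ->
  strictly_convex_on S b ->
  convex_function (dom b) f ->
  (forall x, U x -> gateaux_differentiable f x) ->
  proper_on S g -> lower_semicontinuous_on S g -> convex_on S g ->
  (exists2 p, dom_on S g p & {for p, continuous b} \/ continuous_on_at S g p) ->
  0 < L -> 0 < mu -> U y ->
  (bounded_set S \/
   (~ bounded_set S /\
    exists2 psi : R -> \bar R,
      uniformly_convex_relative b S [set y] psi &
      (psi t * (t^-1)%:E)%E @[t --> +oo] --> +oo%E)) ->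
  minimizer_on S (fun x => Q b f g L mu x y) z ->
  (S `&` U) z ->
  (F z <= Q b f g L mu z y)%E ->
  forall x, S x ->
    ((L / mu)%:E * (bregman b x z - bregman b x y) <= F x - F z)%E.
Proof.
move=> _ _ _ _ b_proper _ b_diff S_dom _ _ cS _ _ f_cvx f_diff.
move=> [g_gtNy [p [Sp gp_ltpy]]] _ g_cvx _ L0 mu0 Uy _ [_ zmin] [Sz Uz].
move=> Fz_le x Sx.
set c := L / mu; have c0 : 0 < c by rewrite divr_gt0.
have QE w (Sw : S w) := Q_E f g L mu b_proper (S_dom w Sw) Uy.
(* Otherwise the objective would be infinite at z, yet it is finite at p. *)
have gz : g z \is a fin_num.
  rewrite fin_real// g_gtNy//=; have := zmin _ Sp.
  rewrite !QE //; case: (g z) => [r _||//]; first exact: ltry.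
  by move: gp_ltpy (g_gtNy _ Sp); case: (g p).
rewrite !bregmanE //; try exact: S_dom.
have [gxy|] := eqVneq (g x) +oo%E.
  by rewrite /F gxy -(fineK gz) addey// leey.
rewrite -ltey => gx_ltpy.
have gx : g x \is a fin_num by rewrite fin_real// g_gtNy.
have [dby lby] := b_diff _ Uy; have [dbz _] := b_diff _ Uz.
have [dfy lfy] := f_diff _ Uy.
(* On S, the objective is phi + c b + g up to an additive constant. *)
pose phi w := grad f y w - c * grad (fine \o b) y w.
have lphi : scalar phi.
  by move=> a u v; rewrite /phi lfy.1 lby.1; ring.
have first_order : fine (g z) - fine (g x) <=
    phi (x - z) + c * grad (fine \o b) z (x - z).
  apply: (composite_minimizer_ineq c0 lphi cS) => //; split=> // w Sw.
  have := zmin w Sw; rewrite !QE // -(fineK gz).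
  rewrite !(scalarB _ _ lfy.1) !(scalarB _ _ lby.1).
  move: (g_gtNy w Sw); case: (g w) => [r _||//]; last by rewrite !addey// !leey.
  by rewrite -!EFinD !lee_fin /phi /= -/c; lra.
have f_ineq := gradient_ineq f_cvx (S_dom _ Sx) (interior_subset Uy) (dfy _).
move: Fz_le; rewrite /F QE // -(fineK gz) -(fineK gx) -EFinN -!EFinD -EFinM !lee_fin.
move: first_order f_ineq; rewrite /phi -/c.
rewrite !(scalarB _ _ lfy.1) !(scalarB _ _ lby.1).
lra.
Qed.
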